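(* Let $a\in\mathbb{R}$ with $|a|<1$, and let $c_k,s_k,\widetilde c_k,\widetilde s_k$ ($k\in\mathbb{N}$) be as follows: $c_k(x)=\sqrt2\cos(2k\pi x)$, $s_k(x)=\sqrt2\sin(2k\pi x)$, $\widehat c_k(x)=\sqrt{1-a^2}\sum_{n\ge0}a^nc_k(2^nx)$, $\widehat s_k(x)=\sqrt{1-a^2}\sum_{n\ge0}a^ns_k(2^nx)$, and $\widetilde c_i=\widehat c_i$, $\widetilde s_i=\widehat s_i$ for $i$ odd, $\widetilde c_i=\sqrt{1-a^2}\,\widehat c_i-a\,c_{i/2}$, $\widetilde s_i=\sqrt{1-a^2}\,\widehat s_i-a\,s_{i/2}$ for $i$ even. If $h\in L^2([0,1])$ has Fourier expansion $$h(x)=\alpha_0+\sum_{n=1}^\infty[\alpha_nc_n(x)+\beta_ns_n(x)],$$ then on $[0,1]$ it also has the expansion $$h(x)=\widetilde\alpha_0+\sum_{n=1}^\infty[\widetilde\alpha_n\widetilde c_n(x)+\widetilde\beta_n\widetilde s_n(x)],$$ where $\widetilde\alpha_0=\alpha_0$ and $$\widetilde\alpha_n=\begin{cases}\sqrt{1-a^2}\sum_{m=0}^\infty a^m\alpha_{n2^m} & n\text{ odd},\\ -a\,\alpha_{n/2}+(1-a^2)\sum_{m=0}^\infty a^m\alpha_{n2^m} & n\text{ even},\end{cases}\qquad \widetilde\beta_n=\begin{cases}\sqrt{1-a^2}\sum_{m=0}^\infty a^m\beta_{n2^m} & n\text{ odd},\\ -a\,\beta_{n/2}+(1-a^2)\sum_{m=0}^\infty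 a^m\beta_{n2^m} & n\text{ even}.\end{cases}$$
   Context: $L^2([0,1])$ carries the inner product $\langle f,h\rangle=\int_0^1fh\,dx$; $\{1,c_k,s_k\}$ and $\{1,\widetilde c_k,\widetilde s_k\}$ are complete orthonormal bases of $L^2([0,1])$, and the expansions are understood in $L^2([0,1])$. *)

(* Defs.v *)
From HB Require Import structures.
From mathcomp Require Import all_boot all_order all_algebra.
From mathcomp Require Import all_classical all_reals all_analysis.
Set Implicit Arguments. Unset Strict Implicit. Unset Printing Implicit Defensive.
Import Order.TTheory GRing.Theory Num.Theory.
Import numFieldNormedType.Exports.
Local Open Scope classical_set_scope.
Local Open Scope ring_scope.

Section Defs.
Variable R : realType.

Definition rsum (u : nat -> R) : R := limn (series u).

Definition ck (k : nat) (x : R) : R := Num.sqrt 2 * cos (2 * k%:R * pi * x).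
Definition sk (k : nat) (x : R) : R := Num.sqrt 2 * sin (2 * k%:R * pi * x).

Definition chat (a : R) (k : nat) (x : R) : R :=
  Num.sqrt (1 - a ^+ 2) * rsum (fun n => a ^+ n * ck k (2 ^+ n * x)).
Definition shat (a : R) (k : nat) (x : R) : R :=
  Num.sqrt (1 - a ^+ 2) * rsum (fun n => a ^+ n * sk k (2 ^+ n * x)).

Definition ctil (a : R) (i : nat) (x : R) : R :=
  if odd i then chat a i x
  else Num.sqrt (1 - a ^+ 2) * chat a i x - a * ck i./2 x.
Definition stil (a : R) (i : nat) (x : R) : R :=
  if odd i then shat a i x
  else Num.sqrt (1 - a ^+ 2) * shat a i x - a * sk i./2 x.

Definition tcoef (a : R) (al : nat -> R) (n : nat) : R :=
  if n == 0%N then al 0%N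
  else if odd n then Num.sqrt (1 - a ^+ 2) * rsum (fun m => a ^+ m * al (n * 2 ^ m)%N)
  else - a * al n./2 + (1 - a ^+ 2) * rsum (fun m => a ^+ m * al (n * 2 ^ m)%N).

Definition psum (al be : nat -> R) (c s : nat -> R -> R) (N : nat) (x : R) : R :=
  al 0%N + \sum_(1 <= n < N.+1) (al n * c n x + be n * s n x).

Definition inL2 (h : R -> R) : Prop :=
  measurable_fun `[0%R : R, 1%R] h /\
  (\int[lebesgue_measure]_(x in `[0%R : R, 1%R]) ((h x) ^+ 2)%:E < +oo)%E.

Definition L2_converges (h : R -> R) (S : nat -> R -> R) : Prop :=
  (fun N => (\int[lebesgue_measure]_(x in `[0%R : R, 1%R])
                ((h x - S N x) ^+ 2)%:E)%E) @ \oo --> 0%E.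

End Defs.

(* Main.v *)
(* Write [G u n] for the sum of [a^m u_(n 2^m)] over [m], so that
   [u_n = G u n - a G u (2n)].  Both the modified coefficients and the modified
   basis functions are obtained by one and the same operation on the sequences
   [al_n], [be_n], [c_n(x)], [s_n(x)]: it sends [u] to [sqrt(1-a^2) G u n] for
   odd [n] and to [G u n - a G u (n/2)] for even [n].  The products of two such
   sequences telescope along [n -> 2n], and the [N]-th modified partial sum
   equals the [N/2]-th Fourier partial sum plus [1-a^2] times
     sum_(N/2 < n <= N) (G al n * G c n + G be n * G s n).
   For each fixed [m] the frequencies [n 2^m] occurring here are pairwise
   distinct and larger than [N/2].  By the Cauchy-Schwarz inequality with the
   weights [|a|^m] and by orthonormality, the squared norm of this remainder is
   at most a constant times the tail of [al_k^2 + be_k^2] over [k > N/2], which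
   tends to 0. *)
Require Import Defs.
From HB Require Import structures.
From mathcomp Require Import all_boot all_order all_algebra.
From mathcomp Require Import all_classical all_reals all_analysis.
From mathcomp Require Import measurable_realfun ring lra.
Import Order.TTheory GRing.Theory Num.Theory.
Import numFieldNormedType.Exports.
Local Open Scope ring_scope.
Local Open Scope classical_set_scope.

(** * Finite sums: limits, continuity, monotonicity *)

Lemma cvg_sum_seq {R : realType} (J : Type) (r : seq J)
    (f : J -> nat -> R) (l : J -> R) :
  (forall j, f j @ \oo --> l j) ->
  (fun K => \sum_(j <- r) f j K) @ \oo --> \sum_(j <- r) l j.
Proof.
move=> fl; elim: r => [|j r IH].
  by under eq_fun do rewrite big_nil; rewrite big_nil; exact: cvg_cst.
by under eq_fun do rewrite big_cons; rewrite big_cons; exact: cvgD.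
Qed.

Lemma continuous_sum {R : realType} (J : Type) (r : seq J) (f : J -> R -> R) :
  (forall j, continuous (f j)) -> continuous (fun x => \sum_(j <- r) f j x).
Proof.
move=> cf; elim: r => [|j r IH] x.
  by under eq_fun do rewrite big_nil; exact: cvg_cst.
under eq_fun do rewrite big_cons.
by apply: cvgD; [exact: cf|exact: IH].
Qed.

Lemma ler_sum_subset {R : numDomainType} (T : eqType) (w : T -> R)
    (s1 s2 : seq T) :
  (forall k, 0 <= w k) -> uniq s1 -> uniq s2 -> {subset s1 <= s2} ->
  \sum_(k <- s1) w k <= \sum_(k <- s2) w k.
Proof.
move=> w0 u1 u2 s12.
have -> : \sum_(k <- s1) w k = \sum_(k <- s2 | k \in s1) w k.
  rewrite -[RHS]big_filter; apply: perm_big; apply: uniq_perm => //.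
    exact: filter_uniq.
  by move=> k; rewrite mem_filter; case: (boolP (k \in s1)) => //= /s12.
by rewrite [leRHS](bigID (mem s1))/= lerDl sumr_ge0.
Qed.

(** * Sums weighted by powers of [a], and Cauchy-Schwarz with the weights [|a| ^+ m] *)

Section GeometricSums.
Context {R : realType} (a : R).
Hypothesis ha : `|a| < 1.

Definition gsum (u : nat -> R) : R := rsum (fun m => a ^+ m * u m).

Lemma is_cvg_gsum (u : nat -> R) (B : R) : (forall m, `|u m| <= B) ->
  cvgn (series (fun m => a ^+ m * u m)).
Proof.
move=> uB; have B0 : 0 <= B by exact: le_trans (normr_ge0 _) (uB 0%N).
apply: normed_cvg; apply: (@series_le_cvg _ _ (geometric B `|a|)).
- by move=> n; exact: normr_ge0.
- by move=> n; rewrite geometric_ge0.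
- move=> n /=; rewrite normrM normrX mulrC.
  by rewrite ler_wpM2r// exprn_ge0.
- by apply: is_cvg_geometric_series; rewrite normr_id.
Qed.

Lemma gsumS (u : nat -> R) (B : R) : (forall m, `|u m| <= B) ->
  gsum u = u 0%N + a * gsum (fun m => u m.+1).
Proof.
move=> uB; have cu := is_cvg_gsum _ _ uB.
have cv := is_cvg_gsum (fun m => u m.+1) B (fun m => uB m.+1).
apply/cvg_lim => //; rewrite -(cvg_shiftS (series _)).
have -> : (fun n => series (fun m => a ^+ m * u m) n.+1) =
    (fun n => u 0%N + a * series (fun m => a ^+ m * u m.+1) n).
  apply/funext => n; rewrite /series /= big_nat_recl// expr0 mul1r.
  congr (_ + _).
  by rewrite mulr_sumr; apply: eq_bigr => i _; rewrite exprS mulrA.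
by apply: cvgD; [exact: cvg_cst|apply: cvgM => //; exact: cvg_cst].
Qed.

Lemma series_geom_abs_le (K : nat) :
  \sum_(0 <= m < K) `|a| ^+ m <= (1 - `|a|)^-1.
Proof.
have := @geometric_seriesE _ 1 `|a|; rewrite lt_eqF// => /(_ isT).
move/(congr1 (fun f => f K)); rewrite /series /=.
under eq_bigr do rewrite mul1r.
by move=> ->; rewrite mul1r ler_pdivrMr ?subr_gt0// mulVf ?gt_eqF ?subr_gt0.
Qed.

(** This is Cauchy-Schwarz for the splitting of each weight into two square roots of [|a| ^+ m].
    Induction on [K] avoids these roots altogether. *)
Lemma cauchy_schwarz_abs (K : nat) (u : nat -> R) :
  (\sum_(0 <= m < K) a ^+ m * u m) ^+ 2 <=
  (\sum_(0 <= m < K) `|a| ^+ m) * \sum_(0 <= m < K) `|a| ^+ m * u m ^+ 2.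
Proof.
elim: K => [|K IH]; first by rewrite !big_nil mulr0 expr0n.
rewrite !big_nat_recr//=.
set A := \sum_(0 <= m < K) a ^+ m * u m in IH *.
set W := \sum_(0 <= m < K) `|a| ^+ m in IH *.
set B := \sum_(0 <= m < K) `|a| ^+ m * u m ^+ 2 in IH *.
have W0 : 0 <= W by apply: sumr_ge0 => i _; rewrite exprn_ge0.
have B0 : 0 <= B.
  apply: sumr_ge0 => i _; apply: mulr_ge0; [exact: exprn_ge0|exact: sqr_ge0].
rewrite -normrX; move: (a ^+ K) (u K) A W B IH W0 B0 => w y A W B IH W0 B0.
have ww : `|w| ^+ 2 = w ^+ 2 by rewrite real_normK ?num_real.
(* The induction hypothesis gives [(2Ay)^2 <= 4 (W y^2) B], which is at most [(W y^2 + B)^2] by the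
   inequality of arithmetic and geometric means. *)
have lin : `|2 * A * y| <= W * y ^+ 2 + B.
  have D0 : 0 <= W * y ^+ 2 + B by rewrite addr_ge0// mulr_ge0// sqr_ge0.
  rewrite -ler_sqr ?nnegrE// real_normK ?num_real//.
  have := ler_wpM2r (sqr_ge0 y) IH; have := sqr_ge0 (W * y ^+ 2 - B); nra.
have h1 : 2 * A * (w * y) <= `|w| * (W * y ^+ 2 + B).
  apply: le_trans (ler_norm _) _.
  have -> : 2 * A * (w * y) = w * (2 * A * y) by ring.
  by rewrite normrM ler_wpM2l.
have -> : (A + w * y) ^+ 2 = A ^+ 2 + 2 * A * (w * y) + `|w| ^+ 2 * y ^+ 2.
  by rewrite ww; ring.
by nra.
Qed.

Lemma cauchy_schwarz_geom (K : nat) (u : nat -> R) :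
  (\sum_(0 <= m < K) a ^+ m * u m) ^+ 2 <=
  (1 - `|a|)^-1 * \sum_(0 <= m < K) `|a| ^+ m * u m ^+ 2.
Proof.
apply: le_trans (cauchy_schwarz_abs _ _) _; apply: ler_wpM2r.
  by apply: sumr_ge0 => i _; apply: mulr_ge0; [exact: exprn_ge0|exact: sqr_ge0].
exact: series_geom_abs_le.
Qed.

(** Apply Cauchy-Schwarz for each [n] and exchange the sums, so that the bound by [e] applies for
    each fixed [m]. One factor [(1 - |a|)^-1] comes from Cauchy-Schwarz, the other from summing the
    weights again. *)
Lemma sum_geom_sqr_le (K : nat) (e : R) (u : nat -> nat -> R) (r : seq nat) :
  (forall m, \sum_(n <- r) u n m ^+ 2 <= e) ->
  \sum_(n <- r) (\sum_(0 <= m < K) a ^+ m * u n m) ^+ 2 <=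
    (1 - `|a|)^-1 ^+ 2 * e.
Proof.
move=> ue; have C0 : 0 <= (1 - `|a|)^-1 by rewrite invr_ge0 subr_ge0 ltW.
have e0 : 0 <= e.
  by apply: le_trans (ue 0%N); apply: sumr_ge0 => i _; exact: sqr_ge0.
apply: le_trans (ler_sum _ (fun n _ => cauchy_schwarz_geom K (u n))) _.
rewrite -mulr_sumr exchange_big/= expr2 -mulrA ler_wpM2l//.
apply: (@le_trans _ _ (\sum_(0 <= m < K) `|a| ^+ m * e)).
  by apply: ler_sum => m _; rewrite -mulr_sumr ler_wpM2l ?exprn_ge0.
by rewrite -mulr_suml ler_wpM2r// series_geom_abs_le.
Qed.

Lemma sum_gsum_sqr_le (e : R) (u : nat -> nat -> R) (r : seq nat) :
  (forall n, exists B, forall m, `|u n m| <= B) ->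
  (forall m, \sum_(n <- r) u n m ^+ 2 <= e) ->
  \sum_(n <- r) gsum (u n) ^+ 2 <= (1 - `|a|)^-1 ^+ 2 * e.
Proof.
move=> uB ue.
have cu n : series (fun m => a ^+ m * u n m) @ \oo --> gsum (u n).
  by have [B] := uB n; exact: is_cvg_gsum.
have cs : (fun K => \sum_(n <- r) series (fun m => a ^+ m * u n m) K ^+ 2)
    @ \oo --> \sum_(n <- r) gsum (u n) ^+ 2.
  by apply: cvg_sum_seq => n; exact: cvgM (cu n) (cu n).
rewrite -(cvg_lim _ cs)//; apply: limr_le; first exact: cvgP cs.
by apply: nearW => K; exact: sum_geom_sqr_le.
Qed.

End GeometricSums.

(** * Orthonormality of the trigonometric system on [[0, 1]] *)

Section Trig.
Context {R : realType}.
Notation mu := (@lebesgue_measure R).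
Notation I := (`[0%R, 1%R]%classic : set R).

Lemma continuous_ck n : continuous (@ck R n).
Proof.
move=> x; apply: cvgM; first exact: cvg_cst.
apply: continuous_comp; last exact: continuous_cos.
by apply: cvgM; [exact: cvg_cst|exact: cvg_id].
Qed.

Lemma continuous_sk n : continuous (@sk R n).
Proof.
move=> x; apply: cvgM; first exact: cvg_cst.
apply: continuous_comp; last exact: continuous_sin.
by apply: cvgM; [exact: cvg_cst|exact: cvg_id].
Qed.

Lemma integrable_continuous (f : R -> R) : continuous f ->
  mu.-integrable I (EFin \o f).
Proof.
move=> cf; apply: continuous_compact_integrable; first exact: segment_compact.
exact: continuous_subspaceT.
Qed.

(** The frequency is an integer because products of harmonics produce the difference [n - m], which
    may be negative. *)
Definition harm (p q : R) (z : int) (x : R) : R :=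
  p * cos (2 * z%:~R * pi * x) + q * sin (2 * z%:~R * pi * x).

Lemma continuous_harm p q z : continuous (harm p q z).
Proof.
move=> x; apply: cvgD; (apply: cvgM; first exact: cvg_cst);
  apply: continuous_comp.
- by apply: cvgM; [exact: cvg_cst|exact: cvg_id].
- exact: continuous_cos.
- by apply: cvgM; [exact: cvg_cst|exact: cvg_id].
- exact: continuous_sin.
Qed.

Lemma sin_2pi_int (z : int) : sin (2 * z%:~R * pi : R) = 0.
Proof.
have P n : sin (2 * n%:R * pi : R) = 0.
  elim: n => [|n IH]; first by rewrite mulr0 mul0r sin0.
  rewrite (_ : _ * pi = 2 * n%:R * pi + pi *+ 2) ?sinD2pi//.
  by rewrite -natr1 -[_ *+ 2]mulr_natl; ring.
case: z => n; first exact: P.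
by rewrite NegzE mulrNz mulrN mulNr sinN P oppr0.
Qed.

Lemma cos_2pi_int (z : int) : cos (2 * z%:~R * pi : R) = 1.
Proof.
have P n : cos (2 * n%:R * pi : R) = 1.
  elim: n => [|n IH]; first by rewrite mulr0 mul0r cos0.
  rewrite (_ : _ * pi = 2 * n%:R * pi + pi *+ 2) ?cosD2pi//.
  by rewrite -natr1 -[_ *+ 2]mulr_natl; ring.
case: z => n; first exact: P.
by rewrite NegzE mulrNz mulrN mulNr cosN P.
Qed.

(** For nonzero [z] the antiderivative [F] has period 1, so it takes equal values at 0 and 1. *)
Lemma integral_harm p q (z : int) :
  (\int[mu]_(x in I) (harm p q z x)%:E = (if z == 0 then p else 0)%:E)%E.
Proof.
have [->|z0] := eqVneq z 0.
  rewrite (eq_integral (cst p%:E)).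
    by rewrite integral_cst//= lebesgue_measure_itv/= lte01 oppr0 adde0 mule1.
  by move=> x _; rewrite /harm mulr0 !mul0r cos0 sin0 mulr1 mulr0 addr0.
set w : R := 2 * z%:~R * pi.
have w0 : w != 0.
  rewrite /w !mulf_eq0 pnatr_eq0 intr_eq0 (negbTE z0).
  exact: lt0r_neq0 (pi_gt0 R).
pose F x := (p * w^-1) * sin (w * x) - (q * w^-1) * cos (w * x).
have dF (x : R) : is_derive x 1 F (harm p q z x).
  have dw : is_derive x 1 (fun y => w * y) w.
    by apply: is_derive_eq; rewrite /GRing.scale/= mulr1.
  have ds : is_derive x 1 (fun y => sin (w * y)) (cos (w * x) * w).
    exact: (is_derive1_comp (is_derive_sin _) dw).
  have dc : is_derive x 1 (fun y => cos (w * y)) (- sin (w * x) * w).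
    exact: (is_derive1_comp (is_derive_cos _) dw).
  rewrite /F; apply: is_derive_eq.
  by rewrite /GRing.scale/= /harm -/w; field.
have cF : continuous F.
  move=> x; apply/differentiable_continuous/derivable1_diffP.
  exact: ex_derive.
rewrite (@continuous_FTC2 _ (harm p q z) F 0 1)//.
- rewrite /F mulr1 mulr0 /w sin_2pi_int cos_2pi_int sin0 cos0.
  by rewrite -EFinB subrr.
- by apply: continuous_subspaceT; exact: continuous_harm.
- split.
  + by move=> x _; exact: ex_derive.
  + by apply: cvg_at_right_filter; exact: cF.
  + by apply: cvg_at_left_filter; exact: cF.
- by move=> x _; rewrite derive1E derive_val.
Qed.

(** Product-to-sum formulas; the two factors [sqrt 2] cancel the halves in them. *)
Lemma harm_mul p q p' q' n m x :
  (p * ck n x + q * sk n x) * (p' * ck m x + q' * sk m x) =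
  harm (p * p' + q * q') (q * p' - p * q') (n%:Z - m%:Z) x +
  harm (p * p' - q * q') (p * q' + q * p') (n%:Z + m%:Z) x.
Proof.
rewrite /harm /ck /sk rmorphB rmorphD/= -!pmulrn.
set A := 2 * n%:R * pi * x; set B := 2 * m%:R * pi * x.
have -> : 2 * (n%:R - m%:R) * pi * x = A - B by rewrite /A /B; ring.
have -> : 2 * (n%:R + m%:R) * pi * x = A + B by rewrite /A /B; ring.
rewrite cosB cosD sinB sinD.
have s2 : Num.sqrt 2 * Num.sqrt 2 = 2 :> R by rewrite -expr2 sqr_sqrtr.
move: (Num.sqrt 2) s2 (cos A) (cos B) (sin A) (sin B) => s s2 cA cB sA sB.
transitivity ((s * s) * ((p * cA + q * sA) * (p' * cB + q' * sB))).
  by ring.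
by rewrite s2; ring.
Qed.

(** Since [n > 0], the frequency [n + m] is nonzero and its harmonic integrates to 0; only the one
    of frequency [n - m] can contribute. *)
Lemma integral_harm_mul p q p' q' (n m : nat) : (0 < n)%N ->
  (\int[mu]_(x in I)
     ((p * ck n x + q * sk n x) * (p' * ck m x + q' * sk m x))%:E
   = (if n == m then p * p' + q * q' else 0)%:E)%E.
Proof.
move=> n0; under eq_integral do rewrite harm_mul EFinD.
rewrite integralD//=; first last.
- exact: integrable_continuous (continuous_harm _ _ _).
- exact: integrable_continuous (continuous_harm _ _ _).
rewrite !integral_harm subr_eq0 eqz_nat -EFinD; congr (_%:E).
by rewrite -PoszD eqz_nat addn_eq0 (gtn_eqF n0)/= addr0.
Qed.

(** The map [k] separates the summation index from the frequency: it is the identity for Fourier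
    blocks and [n -> n 2^m] for dilated ones. *)
Definition tsum (r : seq nat) (k : nat -> nat) (P Q : nat -> R) (x : R) : R :=
  \sum_(n <- r) (P n * ck (k n) x + Q n * sk (k n) x).

Lemma continuous_harmonic p q k :
  continuous (fun x => p * @ck R k x + q * sk k x).
Proof.
move=> x; apply: cvgD; (apply: cvgM; first exact: cvg_cst).
  exact: continuous_ck.
exact: continuous_sk.
Qed.

Lemma continuous_tsum r k P Q : continuous (tsum r k P Q).
Proof. by apply: continuous_sum => n; exact: continuous_harmonic. Qed.

Lemma integral_tsum_sqr r k P Q :
  uniq r -> {in r &, injective k} -> (forall n, n \in r -> (0 < k n)%N) ->
  (\int[mu]_(x in I) (tsum r k P Q x ^+ 2)%:E =
   (\sum_(n <- r) (P n ^+ 2 + Q n ^+ 2))%:E)%E.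
Proof.
move=> ur kinj k0.
pose t n x := P n * ck (k n) x + Q n * sk (k n) x.
have ct n : continuous (t n) by exact: continuous_harmonic.
under eq_integral.
  move=> x _; rewrite expr2 /tsum mulr_suml -sumEFin.
  over.
rewrite integral_sum//=; last first.
  move=> n; apply: (@integrable_continuous (fun x => t n x * tsum r k P Q x)).
  by move=> x; apply: cvgM; [exact: ct|exact: continuous_tsum].
rewrite -sumEFin; apply: eq_big_seq => n nr.
under eq_integral.
  move=> x _; rewrite /tsum mulr_sumr -sumEFin.
  over.
rewrite integral_sum//=; last first.
  move=> m; apply: (@integrable_continuous (fun x => t n x * t m x)).
  by move=> x; apply: cvgM; exact: ct.
rewrite (bigD1_seq n)//= big1_seq ?adde0.
  by rewrite integral_harm_mul ?k0// eqxx !expr2.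
move=> m /andP[mn mr]; rewrite integral_harm_mul ?k0//.
by case: eqP => // /kinj e; rewrite e// eqxx in mn.
Qed.

(** * Mean-square convergence and estimates with extended-real integrals *)

Lemma cvge0P (f : nat -> \bar R) : (forall n, (0 <= f n)%E) ->
  f @ \oo --> 0%E <->
  (forall e, 0 < e -> \forall n \near \oo, (f n <= e%:E)%E).
Proof.
move=> f0; split => [f_cvg e e0|fe].
  have [ffin fcvg] := (fine_cvgP _ _).1 f_cvg.
  have fle : \forall n \near \oo, `|fine (f n)| <= e.
    exact: (@cvgr0_norm_le _ _ _ _ _ _ fcvg e e0).
  near=> n; have fn : f n \is a fin_num by near: n; exact: ffin.
  rewrite -(fineK fn) lee_fin; apply: le_trans (ler_norm _) _.
  by near: n; exact: fle.
apply/fine_cvgP; split.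
  (* The bound by 1 shows that the values are eventually finite, although early ones may be
     infinite. *)
  have := fe 1 ltr01; apply: filterS => n fn1.
  rewrite fin_numE -ltey -ltNye (lt_le_trans _ (f0 n))//=.
  by rewrite (le_lt_trans fn1)// ltry.
apply/cvgr0Pnorm_le => e e0; have := fe e e0; apply: filterS => n fne /=.
rewrite ger0_norm ?fine_ge0//.
have fin : f n \is a fin_num.
  rewrite fin_numE -ltey -ltNye (lt_le_trans _ (f0 n))//=.
  by rewrite (le_lt_trans fne)// ltry.
by rewrite -lee_fin fineK.
Unshelve. all: by end_near. Qed.

Lemma integral_sqr_ge0 (f : R -> R) :
  (0 <= \int[mu]_(x in I) (f x ^+ 2)%:E)%E.
Proof. by apply: integral_ge0 => x _; rewrite lee_fin sqr_ge0. Qed.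

Lemma measurable_sqr (f : R -> R) : measurable_fun I f ->
  measurable_fun I (fun x => (f x ^+ 2)%:E).
Proof. by move=> mf; apply/measurable_EFinP; exact: measurable_funX. Qed.

Lemma measurable_continuous (f : R -> R) : continuous f -> measurable_fun I f.
Proof.
by move=> cf; apply: measurable_funTS; exact: continuous_measurable_fun.
Qed.

Lemma integral_sqrD_le (f g : R -> R) :
  measurable_fun I f -> measurable_fun I g ->
  (\int[mu]_(x in I) ((f x + g x) ^+ 2)%:E <=
   2%:E * \int[mu]_(x in I) (f x ^+ 2)%:E +
   2%:E * \int[mu]_(x in I) (g x ^+ 2)%:E)%E.
Proof.
move=> mf mg; rewrite -!ge0_integralZl//=; try by
  [exact: measurable_sqr|move=> x _; rewrite lee_fin sqr_ge0].
rewrite -ge0_integralD//=; try by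
  [move=> x _; rewrite mule_ge0 ?lee_fin ?sqr_ge0
  |apply: measurable_funeM; exact: measurable_sqr].
apply: ge0_le_integral => //=.
- by move=> x _; rewrite lee_fin sqr_ge0.
- by apply: measurable_sqr; exact: measurable_funD.
- by apply: emeasurable_funD; apply: measurable_funeM; exact: measurable_sqr.
- move=> x _; rewrite -!EFinM -EFinD lee_fin.
  by have := sqr_ge0 (f x - g x); nra.
Qed.

(** Fatou's lemma: the integral of the pointwise limit is at most the lower limit of integrals that
    are all bounded by [e]. *)
Lemma integral_sqr_lim_le (F : nat -> R -> R) (G : R -> R) (e : R) :
  (forall K, measurable_fun I (F K)) -> (forall x, F ^~ x @ \oo --> G x) ->
  (forall K, (\int[mu]_(x in I) (F K x ^+ 2)%:E <= e%:E)%E) ->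
  (\int[mu]_(x in I) (G x ^+ 2)%:E <= e%:E)%E.
Proof.
move=> mF FG Fe.
have -> : (\int[mu]_(x in I) (G x ^+ 2)%:E =
    \int[mu]_(x in I) limn_einf (fun K => (F K x ^+ 2)%:E))%E.
  apply: eq_integral => x _.
  have cF : (fun K => (F K x ^+ 2)%:E) @ \oo --> (G x ^+ 2)%:E.
    by apply: cvg_EFin; [exact: nearW|rewrite !expr2; apply: cvgM; exact: FG].
  by rewrite (cvg_limn_einf_sup cF).1.
apply: le_trans (fatou _ _ _ _) _ => //=.
- by move=> K; exact: measurable_sqr.
- by move=> K x _; rewrite lee_fin sqr_ge0.
apply: le_trans (limn_einf_sup _) _.
rewrite limn_esup_lim; apply: lime_le; first exact: is_cvg_esups.
apply: nearW => K; apply: ge_ereal_sup => _ [m _ <-]; exact: Fe.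
Qed.

End Trig.

(** * The dyadic transform and the telescoping identity for partial sums *)

Section Dyadic.
Context {R : realType} (a : R).
Hypothesis ha : `|a| < 1.
Notation mu := (@lebesgue_measure R).
Notation I := (`[0%R, 1%R]%classic : set R).

(** This is [G u n] of the overview. *)
Definition dyad (u : nat -> R) (n : nat) : R :=
  gsum a (fun m => u (n * 2 ^ m)%N).

Definition bounded_seq (u : nat -> R) := exists B, forall n, `|u n| <= B.

Lemma gsum_cvg (u : nat -> R) : bounded_seq u ->
  (fun K => \sum_(0 <= i < K) a ^+ i * u i) @ \oo --> gsum a u.
Proof. by move=> [B uB]; exact: (is_cvg_gsum a ha u B uB). Qed.

Lemma dyadE (u : nat -> R) (n : nat) : bounded_seq u ->
  dyad u n = u n + a * dyad u n.*2.
Proof.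
move=> [B uB]; rewrite {1}/dyad (@gsumS _ _ ha _ B)// muln1.
congr (_ + _ * gsum _ _).
by apply/funext => m; rewrite expnS mulnA muln2.
Qed.

Lemma tcoef_odd (u : nat -> R) (n : nat) :
  tcoef a u n.*2.+1 = Num.sqrt (1 - a ^+ 2) * dyad u n.*2.+1.
Proof. by rewrite /tcoef/= odd_double. Qed.

(** Substituting [u_q = G u q - a G u (2q)] into [- a u_q + (1 - a^2) G u (2q)] cancels the terms in
    [a^2]. *)
Lemma tcoef_even (u : nat -> R) (n : nat) : bounded_seq u ->
  tcoef a u n.+1.*2 = dyad u n.+1.*2 - a * dyad u n.+1.
Proof.
move=> bu; rewrite /tcoef/= odd_double/= doubleK.
have un := dyadE _ n.+1 bu.
rewrite -/(gsum a _) -/(dyad u n.+1.*2).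
have -> : u n.+1 = dyad u n.+1 - a * dyad u n.+1.*2 by rewrite un addrK.
by ring.
Qed.

(** By induction on [N], following how the window from [N/2 + 1] to [N] moves: every new index
    enters it, and whenever the new index is even, [2q], the index [q] leaves it and joins the first
    sum. *)
Lemma sum_tcoef_mul (u v : nat -> R) (N : nat) :
  bounded_seq u -> bounded_seq v ->
  \sum_(1 <= n < N.+1) tcoef a u n * tcoef a v n =
  \sum_(1 <= n < N./2.+1) u n * v n +
  (1 - a ^+ 2) * \sum_(N./2.+1 <= n < N.+1) dyad u n * dyad v n.
Proof.
move=> bu bv.
have a21 : a ^+ 2 < 1 by rewrite -real_normK ?num_real// expr_lt1.
have sq : Num.sqrt (1 - a ^+ 2) * Num.sqrt (1 - a ^+ 2) = 1 - a ^+ 2.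
  by rewrite -expr2 sqr_sqrtr// subr_ge0 ltW.
elim: N => [|N IH]; first by rewrite !big_geq// mulr0 addr0.
rewrite big_nat_recr//= {}IH.
have [p [->|->]] : exists p, N = p.*2 \/ N = p.*2.+1.
  by exists N./2; rewrite -{1 3}(odd_double_half N); case: odd; [right|left].
(* The new index [2p + 1] is odd: the half stays [p] and the window only gains a term. *)
- rewrite /= uphalf_double doubleK !tcoef_odd.
  rewrite (big_nat_recr p.*2.+1 p.+1)/=; last by rewrite ltnS -addnn leq_addr.
  by rewrite mulrACA sq mulrDr addrA.
(* The new index is [2q] with [q = p + 1]. With [U = G u] and [V = G v], the identity is [(U_2q - a
   U_q)(V_2q - a V_q) = u_q v_q + (1 - a^2)(U_2q V_2q - U_q V_q)]. *)
- rewrite /= uphalf_double doubleK -doubleS !tcoef_even//.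
  have pp : (p.+1 < p.+1.*2)%N by rewrite doubleS ltnS ltnS -addnn leq_addr.
  rewrite (big_nat_recr p.+1 1)//= (big_nat_recr p.+1.*2 p.+2)//= (big_ltn pp).
  have e w : bounded_seq w -> w p.+1 = dyad w p.+1 - a * dyad w p.+1.*2.
    by move=> bw; rewrite {1}(dyadE _ p.+1 bw) addrK.
  by rewrite (e u)// (e v)//; ring.
Qed.

Lemma ckM k m x : @ck R k (2 ^+ m * x) = ck (k * 2 ^ m) x.
Proof. by rewrite /ck natrM natrX; congr (_ * cos _); ring. Qed.

Lemma skM k m x : @sk R k (2 ^+ m * x) = sk (k * 2 ^ m) x.
Proof. by rewrite /sk natrM natrX; congr (_ * sin _); ring. Qed.

(** Dilation by [2^m] multiplies the frequency by [2^m], so at fixed [x] the modified functions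
    arise from [k -> c_k(x)] by the same operation as the coefficients. Index 0 is excluded because
    [tcoef] treats it as a special case. *)
Lemma ctil_tcoef n x : (0 < n)%N -> ctil a n x = tcoef a (@ck R ^~ x) n.
Proof.
move=> n0; have ce : chat a n x = Num.sqrt (1 - a ^+ 2) * dyad (@ck R ^~ x) n.
  by rewrite /chat /dyad /gsum; under eq_fun do rewrite ckM.
have a21 : a ^+ 2 < 1 by rewrite -real_normK ?num_real// expr_lt1.
rewrite /ctil /tcoef gtn_eqF// ce; case: odd => //.
by rewrite mulrA -expr2 sqr_sqrtr ?subr_ge0 1?ltW// addrC mulNr.
Qed.

Lemma stil_tcoef n x : (0 < n)%N -> stil a n x = tcoef a (@sk R ^~ x) n.
Proof.
move=> n0; have ce : shat a n x = Num.sqrt (1 - a ^+ 2) * dyad (@sk R ^~ x) n.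
  by rewrite /shat /dyad /gsum; under eq_fun do rewrite skM.
have a21 : a ^+ 2 < 1 by rewrite -real_normK ?num_real// expr_lt1.
rewrite /stil /tcoef gtn_eqF// ce; case: odd => //.
by rewrite mulrA -expr2 sqr_sqrtr ?subr_ge0 1?ltW// addrC mulNr.
Qed.

Lemma bounded_ck x : bounded_seq (@ck R ^~ x).
Proof.
exists (Num.sqrt 2) => n; rewrite normrM ger0_norm ?sqrtr_ge0//.
by rewrite -[leRHS]mulr1 ler_wpM2l ?sqrtr_ge0// ler_norml cos_geN1 cos_le1.
Qed.

Lemma bounded_sk x : bounded_seq (@sk R ^~ x).
Proof.
exists (Num.sqrt 2) => n; rewrite normrM ger0_norm ?sqrtr_ge0//.
by rewrite -[leRHS]mulr1 ler_wpM2l ?sqrtr_ge0// ler_norml sin_geN1 sin_le1.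
Qed.

Definition remainder (al be : nat -> R) (N : nat) (x : R) : R :=
  \sum_(N./2.+1 <= n < N.+1)
    (dyad al n * dyad (@ck R ^~ x) n + dyad be n * dyad (@sk R ^~ x) n).

Lemma psum_til al be N x : bounded_seq al -> bounded_seq be ->
  psum (tcoef a al) (tcoef a be) (ctil a) (stil a) N x =
  psum al be (@ck R) (@sk R) N./2 x + (1 - a ^+ 2) * remainder al be N x.
Proof.
move=> bal bbe; rewrite /psum.
rewrite (eq_big_nat _ _ (F2 := fun n => tcoef a al n * tcoef a (@ck R ^~ x) n +
    tcoef a be n * tcoef a (@sk R ^~ x) n)); last first.
  by move=> n /andP[n0 _]; rewrite ctil_tcoef// stil_tcoef.
rewrite big_split/= !sum_tcoef_mul//;
  try by [exact: bounded_ck|exact: bounded_sk].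
(* The constant terms agree because [tcoef] leaves the entry at index 0 unchanged. *)
by rewrite /remainder !big_split/= /tcoef/=; ring.
Qed.

(** The map [n -> n 2^m] is injective and sends the window into the indices above [N/2] and up to
    [N 2^m]. *)
Lemma sum_dyadic_le (w : nat -> R) (N m : nat) (e : R) : (forall k, 0 <= w k) ->
  (forall M, (N./2 <= M)%N -> \sum_(N./2.+1 <= k < M.+1) w k <= e) ->
  \sum_(N./2.+1 <= n < N.+1) w (n * 2 ^ m)%N <= e.
Proof.
move=> w0 we; have m0 : (0 < 2 ^ m)%N by rewrite expn_gt0.
have NM : (N <= N * 2 ^ m)%N by exact: leq_pmulr.
have hN : (N./2 <= N)%N by rewrite -divn2 leq_div.
apply: le_trans (we (N * 2 ^ m)%N (leq_trans hN NM)).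
rewrite -(big_map (fun n => n * 2 ^ m)%N xpredT w); apply: ler_sum_subset => //.
- rewrite map_inj_uniq ?iota_uniq// => n n' /eqP.
  by rewrite eqn_pmul2r// => /eqP.
- exact: iota_uniq.
- move=> _ /mapP[n + ->]; rewrite !mem_index_iota => /andP[n1 n2].
  by rewrite (leq_trans n1) ?leq_pmulr//= ltnS leq_pmul2r.
Qed.

End Dyadic.

(** * Coefficient tails and the norm of the remainder *)

Section Convergence.
Context {R : realType} (a : R).
Hypothesis ha : `|a| < 1.
Notation mu := (@lebesgue_measure R).
Notation I := (`[0%R, 1%R]%classic : set R).
Notation C := ((1 - `|a|)^-1).

Lemma continuous_psum (al be : nat -> R) N :
  continuous (psum al be (@ck R) (@sk R) N).
Proof.
move=> x; apply: cvgD; first exact: cvg_cst.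
by apply: continuous_sum => n; exact: continuous_harmonic.
Qed.

Lemma psumB (al be : nat -> R) M N x : (M <= N)%N ->
  psum al be (@ck R) (@sk R) N x - psum al be (@ck R) (@sk R) M x =
  tsum (index_iota M.+1 N.+1) id al be x.
Proof.
move=> MN; rewrite /psum (@big_cat_nat _ _ _ M.+1 1 N.+1)//= /tsum.
by rewrite opprD addrACA subrr add0r addrAC subrr add0r.
Qed.

(** Convergent partial sums form a Cauchy sequence in [L^2], and by orthonormality the squared norm
    of a difference of two of them is the block of squared coefficients. *)
Lemma coef_tail (h : R -> R) (al be : nat -> R) : measurable_fun I h ->
  L2_converges h (psum al be (@ck R) (@sk R)) ->
  forall e, 0 < e -> exists M0, forall M N, (M0 <= M)%N ->
    \sum_(M.+1 <= n < N.+1) (al n ^+ 2 + be n ^+ 2) <= e.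
Proof.
move=> mh hS e e0.
(* Each of the two squared errors enters [integral_sqrD_le] with the factor 2. *)
have e4 : 0 < e / 4 by rewrite divr_gt0.
have [M0 _ M0P] := (cvge0P _ (fun n => integral_sqr_ge0 _)).1 hS _ e4.
exists M0 => M N M0M; have [MN|NM] := leqP M N; last first.
  by rewrite big_geq ?(ltW e0)// ltnS ltnW.
have := @integral_tsum_sqr R (index_iota M.+1 N.+1) id al be (iota_uniq _ _)
  (fun _ _ _ _ e => e).
move=> tE; rewrite -lee_fin -tE; last first.
  by move=> n; rewrite mem_index_iota => /andP[/(leq_ltn_trans (leq0n _))].
have mS K : measurable_fun I (fun x => h x - psum al be (@ck R) (@sk R) K x).
  apply: measurable_funB => //; apply: measurable_continuous.
  exact: continuous_psum.
have -> : (\int[mu]_(x in I) (tsum (index_iota M.+1 N.+1) id al be x ^+ 2)%:E =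
    \int[mu]_(x in I) (((h x - psum al be (@ck R) (@sk R) M x) +
      - (h x - psum al be (@ck R) (@sk R) N x)) ^+ 2)%:E)%E.
  by apply: eq_integral => x _; rewrite -psumB//; congr ((_ ^+ 2)%:E); ring.
apply: le_trans (integral_sqrD_le _ _ (mS M) _) _; first exact: measurable_funN.
under [X in (_ + _ * X)%E]eq_integral do rewrite sqrrN.
have -> : e%:E = (2%:E * (e / 4)%:E + 2%:E * (e / 4)%:E)%E.
  by rewrite -!EFinM -EFinD; congr (_%:E); lra.
apply: leeD; apply: lee_wpmul2l => //=; apply: M0P => //=.
exact: leq_trans MN.
Qed.

Lemma coef_bounded (al be : nat -> R) (M0 : nat) :
  (forall N, \sum_(M0.+1 <= n < N.+1) (al n ^+ 2 + be n ^+ 2) <= 1) ->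
  bounded_seq al.
Proof.
move=> tail.
pose w n := al n ^+ 2 + be n ^+ 2.
have w0 n : 0 <= w n by rewrite addr_ge0// sqr_ge0.
(* The sum covers the indices up to [M0]; the summand 1 covers the tail. Then
   [2 |al n| <= al n ^+ 2 + 1] bounds the coefficient itself. *)
pose B := \sum_(0 <= n < M0.+1) w n + 1.
have wB n : w n <= B.
  have [nM|Mn] := ltnP n M0.+1.
    rewrite /B (bigD1_seq n) ?mem_index_iota ?iota_uniq//= -addrA lerDl.
    by rewrite addr_ge0// sumr_ge0.
  apply: (@le_trans _ _ 1); last by rewrite lerDr sumr_ge0.
  apply: le_trans (tail n).
  rewrite big_nat_recr//= lerDr sumr_ge0 // => i _; exact: w0.
exists (B + 1) => n.
have := wB n; rewrite /w; have := sqr_ge0 (be n); have := sqr_ge0 (`|al n| - 1).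
by rewrite -[al n ^+ 2]real_normK ?num_real//; have := normr_ge0 (al n); nra.
Qed.

(** Cauchy-Schwarz holds pointwise in [x] and is then integrated term by term. *)
Lemma integral_geom_sqr_le (v : nat -> R -> R) (V : R) (K : nat) :
  (forall i, continuous (v i)) ->
  (forall i, (\int[mu]_(x in I) (v i x ^+ 2)%:E = V%:E)%E) ->
  (\int[mu]_(x in I) ((\sum_(0 <= i < K) a ^+ i * v i x) ^+ 2)%:E <=
   (C ^+ 2 * V)%:E)%E.
Proof.
move=> cv vV.
have C0 : 0 <= C by rewrite invr_ge0 subr_ge0 ltW.
have V0 : 0 <= V by rewrite -lee_fin -(vV 0%N) integral_sqr_ge0.
have csq i : continuous (fun x => v i x ^+ 2).
  by move=> x; exact: cvgM (cv i x) (cv i x).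
have cv2 i : continuous (fun x => `|a| ^+ i * v i x ^+ 2).
  by move=> x; apply: cvgM; [exact: cvg_cst|exact: csq].
have cS : continuous (fun x => \sum_(0 <= i < K) `|a| ^+ i * v i x ^+ 2).
  exact: continuous_sum.
have cav : continuous (fun x => \sum_(0 <= i < K) a ^+ i * v i x).
  by apply: continuous_sum => i x; apply: cvgM; [exact: cvg_cst|exact: cv].
apply: (@le_trans _ _ (\int[mu]_(x in I)
    (C%:E * (\sum_(0 <= i < K) `|a| ^+ i * v i x ^+ 2)%:E))%E).
  apply: ge0_le_integral => //=.
  - by move=> x _; rewrite lee_fin sqr_ge0.
  - by apply: measurable_sqr; exact: measurable_continuous.
  - apply: measurable_funeM; apply/measurable_EFinP.
    exact: measurable_continuous.
  - by move=> x _; rewrite -EFinM lee_fin; exact: cauchy_schwarz_geom.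
rewrite integralZl//=; last exact: integrable_continuous cS.
under eq_integral do rewrite -sumEFin.
rewrite integral_sum//=; last by move=> i; exact: integrable_continuous (cv2 i).
under eq_bigr => i _.
  under eq_integral do rewrite EFinM.
  rewrite integralZl//=; last exact: integrable_continuous (csq i).
  rewrite vV -EFinM; over.
rewrite sumEFin -EFinM lee_fin expr2 -mulrA ler_wpM2l//.
by rewrite -mulr_suml ler_wpM2r// series_geom_abs_le.
Qed.

(** Expanding only the transforms of the basis functions writes the remainder as the sum of
    [a^i v_i], where every [v_i] has the same squared norm [V] by orthonormality. Two factors [C]
    come from this sum over [i]; the other two come from [V <= 2 C^2 e], where the transforms of
    [al] and [be] are estimated separately. *)
Lemma integral_remainder_le (al be : nat -> R) (N : nat) (e : R) :
  bounded_seq al -> bounded_seq be ->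
  (forall M, \sum_(N./2.+1 <= k < M.+1) (al k ^+ 2 + be k ^+ 2) <= e) ->
  (\int[mu]_(x in I) (remainder a al be N x ^+ 2)%:E <=
   (C ^+ 4 * (2 * e))%:E)%E.
Proof.
move=> bal bbe tail.
have C0 : 0 <= C by rewrite invr_ge0 subr_ge0 ltW.
set r := index_iota N./2.+1 N.+1.
have dyad_le u : bounded_seq u ->
    (forall M, \sum_(N./2.+1 <= k < M.+1) u k ^+ 2 <= e) ->
    \sum_(n <- r) dyad a u n ^+ 2 <= C ^+ 2 * e.
  move=> [B uB] ue.
  apply: (@sum_gsum_sqr_le _ a ha e (fun n m => u (n * 2 ^ m)%N)) => [n|m].
    by exists B => m; exact: uB.
  by apply: (sum_dyadic_le (fun k => u k ^+ 2)) => // k; exact: sqr_ge0.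
have le_al : \sum_(n <- r) dyad a al n ^+ 2 <= C ^+ 2 * e.
  apply: dyad_le => // M; apply: le_trans (tail M); apply: ler_sum => k _.
  by rewrite lerDl sqr_ge0.
have le_be : \sum_(n <- r) dyad a be n ^+ 2 <= C ^+ 2 * e.
  apply: dyad_le => // M; apply: le_trans (tail M); apply: ler_sum => k _.
  by rewrite lerDr sqr_ge0.
pose v i := tsum r (fun n => n * 2 ^ i)%N (dyad a al) (dyad a be).
pose V := \sum_(n <- r) (dyad a al n ^+ 2 + dyad a be n ^+ 2).
have cv i : continuous (v i) by exact: continuous_tsum.
have vV i : (\int[mu]_(x in I) (v i x ^+ 2)%:E = V%:E)%E.
  apply: integral_tsum_sqr; first exact: iota_uniq.
  - by move=> n n' _ _ /eqP; rewrite eqn_pmul2r ?expn_gt0// => /eqP.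
  - move=> n; rewrite mem_index_iota => /andP[n0 _].
    by rewrite muln_gt0 expn_gt0 (leq_ltn_trans _ n0).
apply: (@le_trans _ _ (C ^+ 2 * V)%:E); last first.
  have -> : C ^+ 4 * (2 * e) = C ^+ 2 * (C ^+ 2 * e + C ^+ 2 * e) by ring.
  by rewrite lee_fin ler_wpM2l ?exprn_ge0// /V big_split lerD.
(* The truncated sums over [i] converge pointwise to the remainder, so a bound uniform in [K] passes
   to the limit. *)
apply: (@integral_sqr_lim_le _ (fun K x => \sum_(0 <= i < K) a ^+ i * v i x)).
- move=> K; apply: measurable_continuous; apply: continuous_sum => i x.
  by apply: cvgM; [exact: cvg_cst|exact: cv].
- move=> x.
  rewrite (_ : (fun K => _) = (fun K => \sum_(n <- r)
      (dyad a al n * \sum_(0 <= i < K) a ^+ i * ck (n * 2 ^ i) x +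
       dyad a be n * \sum_(0 <= i < K) a ^+ i * sk (n * 2 ^ i) x))); last first.
    apply/funext => K.
    under eq_bigr do rewrite /v /tsum mulr_sumr.
    rewrite exchange_big/=; apply: eq_bigr => n _.
    rewrite !mulr_sumr -big_split/=; apply: eq_bigr => i _; ring.
  apply: cvg_sum_seq => n; apply: cvgD; (apply: cvgM; first exact: cvg_cst).
    have [B uB] := @bounded_ck R x.
    apply: (gsum_cvg a ha (fun m => ck (n * 2 ^ m) x)).
    by exists B => m; exact: uB.
  have [B uB] := @bounded_sk R x.
  apply: (gsum_cvg a ha (fun m => sk (n * 2 ^ m) x)).
  by exists B => m; exact: uB.
- by move=> K; exact: integral_geom_sqr_le.
Qed.

Lemma measurable_remainder (al be : nat -> R) (N : nat) :
  measurable_fun I (remainder a al be N).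
Proof.
have md (f : nat -> R -> R) n : (forall k, continuous (f k)) ->
    (forall x, bounded_seq (f ^~ x)) ->
    measurable_fun I (fun x => dyad a (f ^~ x) n).
  move=> cf bf; apply: (@measurable_fun_cvg _ _ _ _
      (fun K x => \sum_(0 <= i < K) a ^+ i * f (n * 2 ^ i)%N x)).
    move=> K; apply: measurable_continuous; apply: continuous_sum => i x.
    by apply: cvgM; [exact: cvg_cst|exact: cf].
  move=> x _; have [B fB] := bf x.
  apply: (gsum_cvg a ha (fun m => f (n * 2 ^ m)%N x)).
  by exists B => m; exact: fB.
apply: measurable_sum => n; apply: measurable_funD;
  apply: measurable_funM => //.
- by apply: md; [exact: continuous_ck|exact: bounded_ck].
- by apply: md; [exact: continuous_sk|exact: bounded_sk].
Qed.

End Convergence.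

(** * Mean-square convergence of the modified expansion *)

Theorem theorem5p3 (R : realType) (a : R) (ha : `|a| < 1)
  (h : R -> R) (al be : nat -> R) :
  inL2 h ->
  L2_converges h (psum al be (@ck R) (@sk R)) ->
  L2_converges h (psum (tcoef a al) (tcoef a be) (ctil a) (stil a)).
Proof.
move=> [mh _] hS.
have tail := coef_tail _ _ _ mh hS.
have [M1 tail1] := tail 1 ltr01.
have bal : bounded_seq al by apply: (coef_bounded al be M1) => N; exact: tail1.
have bbe : bounded_seq be.
  apply: (coef_bounded be al M1) => N; apply: le_trans (tail1 _ N (leqnn _)).
  by apply: ler_sum => n _; rewrite addrC.
have a21 : a ^+ 2 < 1 by rewrite -real_normK ?num_real// expr_lt1.
apply/cvge0P => [n|e e0]; first exact: integral_sqr_ge0.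
set C := (1 - `|a|)^-1.
have C0 : 0 < C by rewrite invr_gt0 subr_gt0.
have e4 : 0 < e / 4 by rewrite divr_gt0.
(* With this tail the bound [C^4 * (2 * _)] on the squared norm of the remainder equals [e / 4]. *)
have d0 : 0 < e / (8 * C ^+ 4) by rewrite divr_gt0// mulr_gt0// exprn_gt0.
have [M2 tail2] := tail _ d0.
have [M3 _ M3P] := (cvge0P _ (fun n => integral_sqr_ge0 _)).1 hS _ e4.
(* Doubling is needed because the Fourier sum and the tail start from [N/2]. *)
exists (maxn M2 M3).*2 => // N /= MN.
have : (maxn M2 M3 <= N./2)%N by rewrite -(doubleK (maxn M2 M3)) half_leq.
rewrite geq_max => /andP[M2N M3N].
pose S := psum al be (@ck R) (@sk R) N./2.
have -> : (\int[@lebesgue_measure R]_(x in `[0%R, 1%R]%classic)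
    ((h x - psum (tcoef a al) (tcoef a be) (ctil a) (stil a) N x) ^+ 2)%:E =
    \int[@lebesgue_measure R]_(x in `[0%R, 1%R]%classic)
    (((h x - S x) + - (1 - a ^+ 2) * remainder a al be N x) ^+ 2)%:E)%E.
  apply: eq_integral => x _; rewrite psum_til// -/S; congr ((_ ^+ 2)%:E).
  by rewrite opprD addrA mulNr.
apply: le_trans (integral_sqrD_le _ _ _ _) _.
- apply: measurable_funB => //; apply: measurable_continuous.
  exact: continuous_psum.
- by apply: measurable_funM => //; exact: measurable_remainder.
have -> : e%:E = (2%:E * (e / 4)%:E + 2%:E * (e / 4)%:E)%E.
  by rewrite -!EFinM -EFinD; congr (_%:E); lra.
apply: leeD; apply: lee_wpmul2l => //=; first exact: M3P.
(* The factor [(1 - a^2)^2] is at most 1. *)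
apply: (@le_trans _ _ (\int[@lebesgue_measure R]_(x in `[0%R, 1%R]%classic)
    (remainder a al be N x ^+ 2)%:E)%E).
  apply: ge0_le_integral => //=.
  - by move=> x _; rewrite lee_fin sqr_ge0.
  - apply: measurable_sqr; apply: measurable_funM => //.
    exact: measurable_remainder.
  - by apply: measurable_sqr; exact: measurable_remainder.
  - move=> x _; rewrite lee_fin exprMn -[leRHS]mul1r ler_wpM2r ?sqr_ge0// sqrrN.
    by rewrite expr_le1 ?subr_ge0 ?(ltW a21)// lerBlDr lerDl sqr_ge0.
apply: le_trans (integral_remainder_le a ha _ _ _ _ bal bbe (tail2 _ ^~ M2N)) _.
rewrite lee_fin -/C le_eqVlt; apply/orP; left; apply/eqP; field.
by rewrite gt_eqF.
Qed.
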